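(* Let $T^*:=\frac1\mu\ln M$. Assume $T_{2n}\ge\tau$ and $T_{2n}>T^*$ for all $n\in\mathbb N$, and set $c_n:=M^2e^{-2\mu T_{2n}}\in(0,1)$. If $$\sum_{n=0}^\infty \ln\left[e^{2B_{2n+1}T_{2n+1}}\left(c_n+T_{2n+1}B_{2n+1}\right)\right]=-\infty,$$ then the equation $U_t(t)=\mathcal A U(t)+\mathcal B(t)U(t-\tau)$, $t>0$, $U(0)=U_0$, is asymptotically stable, namely for every $U_0\in\mathcal H$ its solution $U$ satisfies $\|U(t)\|\to0$ as $t\to+\infty$.
   Context: $\mathcal H$ is a Hilbert space with norm $\|\cdot\|$, and $\mathcal L(\mathcal H)$ is the space of bounded linear operators from $\mathcal H$ to itself. $\mathcal A$ is a dissipative (in general unbounded) linear operator in $\mathcal H$ generating a $C_0$-semigroup $(S(t))_{t\ge 0}$, and $M,\mu>0$ are constants with $\|S(t)\|_{\mathcal L(\mathcal H)}\le Me^{-\mu t}$ for all $t\ge 0$. The delay $\tau>0$ is a fixed constant. $\mathbb N=\{0,1,2,\dots\}$. There is a strictly increasing sequence of real numbers $(t_n)_{n\in\mathbb N}$ with $t_0=0$; put $I_n=[t_n,t_{n+1})$ and $T_n=t_{n+1}-t_n$. For each $n\in\mathbb N$, $\mathcal B(t)=0$ for $t\in I_{2n}$ and $\mathcal B(t)=\mathcal B_{2n+1}$ for $t\in I_{2n+1}$, where $\mathcal B_{2n+1}\in\mathcal L(\mathcal H)$ is a fixed operator; $B_{2n+1}:=\|\mathcal B_{2n+1}\|_{\mathcal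 L(\mathcal H)}$. A solution means a mild solution: a function $U\in C([0,\infty);\mathcal H)$ satisfying $U(t)=S(t)U_0+\int_0^t S(t-s)\mathcal B(s)U(s-\tau)\,ds$ for all $t\ge0$. The integrand is taken to be $0$ wherever $\mathcal B(s)=0$; in particular this is so for $s<t_1$, where $t_1\ge\tau$, so no values of $U$ at negative times are needed. *)

(* Defs.v *)
From Stdlib Require Import Reals.
From Coquelicot Require Import Coquelicot.
Open Scope R_scope.

(* Scalars are real because Coquelicot's integral [RInt] is real-linear.  A
   complex Hilbert space is covered through its underlying real space with inner
   product [Re <x, y>]: the norm, operator norms, generators, mild solutions and
   dissipativity ([Re <A u, u> <= 0]) are unchanged. *)
Record HilbertSpace := {
  hilbert_car :> CompleteNormedModule R_AbsRing;
  inner : hilbert_car -> hilbert_car -> R;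
  inner_sym : forall x y, inner x y = inner y x;
  inner_plus_l : forall x y z, inner (plus x y) z = inner x z + inner y z;
  inner_scal_l : forall (a : R) x y, inner (scal a x) y = a * inner x y;
  inner_norm : forall x, inner x x = norm x ^ 2
}.

Arguments inner {h} _ _.

(* Coquelicot's [is_linear] includes boundedness, so [is_linear L] says that L
   belongs to L(H).  [op_norm] is only meaningful for such L: [real] would send
   an infinite supremum to 0. *)
Definition op_norm {H : HilbertSpace} (L : H -> H) : R :=
  real (Lub_Rbar (fun r => exists x : H, norm x <= 1 /\ r = norm (L x))).

(* [uop] is total for convenience; its values outside [dom] are irrelevant. *)
Record unbounded_operator (H : HilbertSpace) := {
  dom : H -> Prop;
  uop : H -> H;
  dom_zero : dom zero;
  dom_plus : forall x y, dom x -> dom y -> dom (plus x y);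
  dom_scal : forall (a : R) x, dom x -> dom (scal a x);
  uop_plus : forall x y, dom x -> dom y -> uop (plus x y) = plus (uop x) (uop y);
  uop_scal : forall (a : R) x, dom x -> uop (scal a x) = scal a (uop x)
}.

Arguments dom {H} _ _.
Arguments uop {H} _ _.

Definition dissipative {H : HilbertSpace} (A : unbounded_operator H) : Prop :=
  forall u, dom A u -> inner (uop A u) u <= 0.

(* Semigroups are total in time; only nonnegative times are constrained or used. *)
Record is_C0_semigroup {H : HilbertSpace} (Sg : R -> H -> H) : Prop := {
  C0_linear : forall t, 0 <= t -> is_linear (Sg t);
  C0_zero : forall x, Sg 0 x = x;
  C0_plus : forall s t x, 0 <= s -> 0 <= t -> Sg (s + t) x = Sg s (Sg t x);
  C0_continuous : forall x, filterlim (fun h => Sg h x) (at_right 0) (locally x)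
}.

Definition is_generator {H : HilbertSpace}
    (A : unbounded_operator H) (Sg : R -> H -> H) : Prop :=
  forall x y : H,
    (dom A x /\ uop A x = y) <->
    filterlim (fun h : R => scal (/ h) (minus (Sg h x) x)) (at_right 0) (locally y).

(* Values of U at negative times enter only through [B s (U (s - tau))] with
   s < tau; they play no role when [B s] is the zero map there. *)
Definition mild_solution {H : HilbertSpace} (Sg : R -> H -> H) (B : R -> H -> H)
    (tau : R) (U0 : H) (U : R -> H) : Prop :=
  continuous_on (fun t => 0 <= t) U /\
  forall t, 0 <= t ->
    ex_RInt (fun s => Sg (t - s) (B s (U (s - tau)))) 0 t /\
    U t = plus (Sg t U0) (RInt (fun s => Sg (t - s) (B s (U (s - tau)))) 0 t).

Definition asymptotically_stable {H : HilbertSpace} (Sg : R -> H -> H)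
    (B : R -> H -> H) (tau : R) : Prop :=
  forall (U0 : H) (U : R -> H),
    mild_solution Sg B tau U0 U ->
    is_lim (fun t => norm (U t)) p_infty 0.

(* Main.v *)
From Stdlib Require Import Lra Lia.
Require Import Defs.
From Stdlib Require Import Reals.
From Coquelicot Require Import Coquelicot.
Open Scope R_scope.

(** Write [p = t_2n], [q = t_(2n+1)], [r = t_(2n+2)] for the ends of a cycle, [b]
    for the norm of its feedback operator and [c = M^2 exp (-2 mu (q - p))]. The
    whole proof is the cycle estimate
    [|U r|^2 <= exp (2 b (r - q)) (c + (r - q) b) |U p|^2]. Multiplying these
    factors, the hypothesis on the sum of their logarithms sends [|U (t_2n)|] to 0;
    the same estimate at intermediate times of the cycle controls [U] between
    these points, and [t_2n >= n tau] makes the cycles cover the half-line.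

    The cycle estimate needs two properties of the semigroup. Exponential decay
    gives [|S(t - q) U q| <= sqrt c |U p|] for [t >= q]. The contraction property
    [|S(t)| <= 1] is what keeps the constant [M] out of the Duhamel integral and
    gives [|U| <= |U p|] on [[p, q]], a history at least as long as the delay. It
    follows from dissipativity ([dissipative_contraction]): averages of orbits lie
    in the domain of the generator, and the squared norm decreases along their
    orbits.

    On [[q, r]] the mild formula restarted at [q] ([mild_solution_restart]) bounds
    [|U t|] by [sqrt c |U p|] plus the integral of [b |U (s - tau)|]. The function
    [growth b c (t - q) = exp (b (t - q)) sqrt (c + b (t - q))] starts at [sqrt c]
    and satisfies [growth' >= b max(1, growth)] ([growth_deriv_ge]), so
    [|U p| growth] is a supersolution of this inequality, and since the delay is
    positive a finite induction over steps of length [tau] compares the two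
    ([delayed_feedback_bound]). Its square is exactly the factor in the cycle
    estimate, so no loss occurs in passing from the integral inequality to the
    criterion. *)

(** * Bounded linear maps *)

Lemma norm_scal_le (V : NormedModule R_AbsRing) (a : R) (x : V) :
  norm (scal a x) <= Rabs a * norm x.
Proof. exact (norm_scal (V := V) a x). Qed.

Lemma hilbert_norm_zero (H : HilbertSpace) : norm (zero : H) = 0.
Proof. exact (norm_zero (V := H)). Qed.

Lemma norm_le_op_norm (H : HilbertSpace) (L : H -> H) (x : H) :
  is_linear L -> norm (L x) <= op_norm L * norm x.
Proof.
intros HL.
assert (Hunit : forall y : H, norm y <= 1 -> norm (L y) <= op_norm L).
{ intros y Hy; unfold op_norm.
  set (E := fun r => exists z : H, norm z <= 1 /\ r = norm (L z)).
  destruct (Lub_Rbar_correct E) as [Hub Hleast].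
  destruct (linear_norm L HL) as [K [HK HLK]].
  assert (HKub : Rbar_le (Lub_Rbar E) K).
  { apply Hleast; intros r [z [Hz ->]]; simpl.
    pose proof (HLK z); nra. }
  assert (Hy' : Rbar_le (norm (L y)) (Lub_Rbar E)) by (apply Hub; exists y; auto).
  destruct (Lub_Rbar E); simpl in *; easy. }
destruct (Req_dec (norm x) 0) as [Hx | Hx].
- rewrite (norm_eq_zero x Hx), (linear_zero L HL), !norm_zero; lra.
- assert (Hpos : 0 < norm x) by (pose proof (norm_ge_0 x); lra).
  assert (Hinv : 0 < / norm x) by (apply Rinv_0_lt_compat; lra).
  pose proof (norm_scal (/ norm x) x) as Hx1.
  change abs with Rabs in Hx1; rewrite (Rabs_pos_eq (/ norm x)) in Hx1 by lra.
  rewrite Rinv_l in Hx1 by exact Hx.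
  pose proof (norm_scal (norm x) (L (scal (/ norm x) x))) as Hx2.
  change abs with Rabs in Hx2; rewrite (Rabs_pos_eq (norm x)) in Hx2 by lra.
  rewrite <- (linear_scal L HL), scal_assoc in Hx2.
  change (mult (norm x) (/ norm x)) with (norm x * / norm x) in Hx2.
  rewrite Rinv_r in Hx2 by exact Hx.
  change 1 with (one : R_AbsRing) in Hx2; rewrite scal_one in Hx2.
  apply Rle_trans with (1 := Hx2); rewrite Rmult_comm.
  apply Rmult_le_compat_r; [lra | exact (Hunit _ Hx1)].
Qed.

Lemma op_norm_ge_0 (H : HilbertSpace) (L : H -> H) :
  is_linear L -> 0 <= op_norm L.
Proof.
intros HL; unfold op_norm.
set (E := fun r => exists z : H, norm z <= 1 /\ r = norm (L z)).
destruct (Lub_Rbar_correct E) as [Hub _].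
assert (H0 : Rbar_le 0 (Lub_Rbar E)).
{ apply Hub; exists zero.
  change (norm (zero : H) <= 1 /\ 0 = norm (L (zero : H))).
  rewrite (linear_zero L HL : L (zero : H) = zero), hilbert_norm_zero.
  split; [lra | easy]. }
destruct (Lub_Rbar E); simpl in *; lra.
Qed.

Lemma is_RInt_linear (V W : NormedModule R_AbsRing) (L : V -> W)
    (f : R -> V) (a b : R) (l : V) :
  is_linear L -> is_RInt f a b l -> is_RInt (fun s => L (f s)) a b (L l).
Proof.
intros HL Hf.
apply filterlim_ext with (fun ptd => L (scal (sign (b - a)) (Riemann_sum f ptd))).
- intros ptd; rewrite (linear_scal L HL); f_equal.
  apply SF_cons_ind with (s := ptd).
  + intros x0; unfold Riemann_sum; simpl; apply (linear_zero L HL).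
  + intros h s IH.
    rewrite !Riemann_sum_cons, (linear_plus L HL), (linear_scal L HL), IH.
    easy.
- apply filterlim_comp with (1 := Hf), linear_cont, HL.
Qed.

(** * Derivatives in a Hilbert space *)

Lemma plus_minus_r (G : AbelianGroup) (x y : G) : y = plus x (minus y x).
Proof.
unfold minus; rewrite (plus_comm y), plus_assoc, plus_opp_r, plus_zero_l; easy.
Qed.

Lemma norm_minus_sym (V : NormedModule R_AbsRing) (x y : V) :
  norm (minus x y) = norm (minus y x).
Proof. rewrite <- norm_opp, opp_minus; easy. Qed.

Lemma inner_plus_r (H : HilbertSpace) (x y z : H) :
  inner x (plus y z) = inner x y + inner x z.
Proof. rewrite inner_sym, inner_plus_l, !(inner_sym _ x); easy. Qed.

Lemma inner_scal_r (H : HilbertSpace) (a : R) (x y : H) :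
  inner x (scal a y) = a * inner x y.
Proof. rewrite inner_sym, inner_scal_l, inner_sym; easy. Qed.

Lemma norm_sqr_plus (H : HilbertSpace) (x d : H) :
  norm (plus x d) ^ 2 = norm x ^ 2 + 2 * inner x d + norm d ^ 2.
Proof.
rewrite <- !inner_norm, inner_plus_l, !inner_plus_r, (inner_sym _ d x); ring.
Qed.

(** Cauchy-Schwarz, here by polarisation: [2 <x, y> = |x + y|^2 - |x|^2 - |y|^2]
    and the triangle inequality. *)
Lemma inner_le (H : HilbertSpace) (x y : H) : Rabs (inner x y) <= norm x * norm y.
Proof.
assert (Hle : forall y' : H, inner x y' <= norm x * norm y').
{ intros y'.
  pose proof (norm_sqr_plus H x y') as Hp.
  assert (Ht : norm (plus x y') <= norm x + norm y') by exact (norm_triangle x y').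
  assert (Hp0 : 0 <= norm (plus x y')) by exact (norm_ge_0 _).
  nra. }
pose proof (Hle y) as H1.
pose proof (Hle (scal (-1) y)) as H2.
assert (H3 : norm (scal (-1) y) <= Rabs (-1) * norm y) by exact (norm_scal_le H _ y).
rewrite Rabs_left in H3 by lra.
assert (H4 : inner x (scal (-1) y) = -1 * inner x y) by apply inner_scal_r.
pose proof (norm_ge_0 x).
apply Rabs_le.
assert (H5 : norm x * norm (scal (-1) y) <= norm x * norm y).
{ apply Rmult_le_compat_l; [easy | lra]. }
split; [apply Ropp_le_cancel | exact H1].
rewrite Ropp_involutive; lra.
Qed.

(** The remainder of the expansion of [|x + d|^2] is exactly [|d|^2]. *)
Lemma filterdiff_norm_sqr (H : HilbertSpace) (x : H) :
  filterdiff (fun y : H => norm y ^ 2) (locally x) (fun d => 2 * inner x d).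
Proof.
split.
- split.
  + intros u v; rewrite inner_plus_r; unfold plus; simpl; ring.
  + intros k u; rewrite inner_scal_r; unfold scal; simpl; unfold mult; simpl; ring.
  + exists (2 * norm x + 1); split; [pose proof (norm_ge_0 x); lra |].
    intros u; unfold norm at 1; simpl; unfold abs; simpl.
    rewrite Rabs_mult, (Rabs_pos_eq 2) by lra.
    pose proof (inner_le H x u); pose proof (norm_ge_0 u); nra.
- intros z Hz eps.
  assert (Hxz : x = z) by exact (is_filter_lim_locally_unique (V := H) x z Hz).
  subst z; clear Hz.
  apply (locally_le_locally_norm (V := H) x).
  exists eps; intros y Hy.
  change (norm (minus y x) < eps) in Hy.
  revert Hy; generalize (plus_minus_r H x y : y = plus x (minus y x)).
  generalize (minus y x : H); intros d -> Hd.
  change (Rabs (norm (plus x d) ^ 2 - norm x ^ 2 - 2 * inner x d) <= eps * norm d).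
  rewrite norm_sqr_plus.
  assert (Hd0 : 0 <= norm d) by exact (norm_ge_0 _).
  rewrite Rabs_pos_eq by nra; nra.
Qed.

Lemma is_derive_norm_sqr (H : HilbertSpace) (G : R -> H) (t : R) (l : H) :
  is_derive G t l -> is_derive (fun s => norm (G s) ^ 2) t (2 * inner (G t) l).
Proof.
intros HG.
pose proof (filterdiff_comp' _ _ _ _ _ HG (filterdiff_norm_sqr H (G t))) as Hc.
apply (filterdiff_ext_lin _ _ _ Hc).
intros y; rewrite inner_scal_r; unfold scal; simpl; unfold mult; simpl; ring.
Qed.

Lemma scal_inv_minus (V : NormedModule R_AbsRing) (k : R) (x l : V) :
  k <> 0 -> scal (/ k) (minus x (scal k l)) = minus (scal (/ k) x) l.
Proof.
intros Hk; transitivity (minus (scal (/ k) x) (scal (/ k) (scal k l))).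
- exact (scal_minus_distr_l (V := V) (/ k) x (scal k l)).
- f_equal; transitivity (scal (one : R_AbsRing) l).
  + rewrite scal_assoc; f_equal; apply Rinv_l, Hk.
  + exact (scal_one (V := V) l).
Qed.

Lemma is_derive_filterlim_right (V : NormedModule R_AbsRing) (G : R -> V)
    (t : R) (l : V) :
  is_derive G t l ->
  filterlim (fun k => scal (/ k) (minus (G (t + k)) (G t))) (at_right 0) (locally l).
Proof.
intros [_ HG]; apply filterlim_locally; intros eps.
assert (He : 0 < eps / 2) by (pose proof (cond_pos eps); lra).
destruct (HG t (fun P HP => HP) (mkposreal _ He)) as [delta Hd].
exists delta; intros k Hk Hk0; apply norm_compat1.
assert (Hcancel : forall u v : R, u + v + - u = v) by (intros; ring).
assert (Hkd : Rabs k < delta).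
{ change (Rabs (k + - 0) < delta) in Hk.
  rewrite Ropp_0, Rplus_0_r in Hk; easy. }
assert (Hball : ball t delta (t + k)).
{ change (Rabs (t + k + - t) < delta).
  rewrite Hcancel; easy. }
specialize (Hd _ Hball); cbv beta in Hd.
assert (Hd' : norm (minus (minus (G (t + k)) (G t)) (scal (t + k + - t) l))
              <= eps / 2 * Rabs (t + k + - t)) by exact Hd.
rewrite Hcancel in Hd'.
rewrite (Rabs_pos_eq k) in Hd' by (left; exact Hk0).
apply Rle_lt_trans with
  (norm (scal (/ k) (minus (minus (G (t + k)) (G t)) (scal k l)))).
{ right; f_equal; symmetry; apply scal_inv_minus, Rgt_not_eq, Hk0. }
apply Rle_lt_trans with (1 := norm_scal_le _ _ _).
assert (0 < / k) by (apply Rinv_0_lt_compat; lra).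
rewrite Rabs_pos_eq by lra.
apply Rle_lt_trans with (/ k * (eps / 2 * k)).
- apply Rmult_le_compat_l; [lra | exact Hd'].
- replace (/ k * (eps / 2 * k)) with (eps / 2) by (field; lra).
  pose proof (cond_pos eps); lra.
Qed.

(** * Contraction property of dissipative semigroups *)

Lemma continuous_norm_lt (V : NormedModule R_AbsRing) (f : R -> V) (x : R) :
  (forall eps : R, 0 < eps -> exists delta : posreal,
     forall y, Rabs (y - x) < delta -> norm (minus (f y) (f x)) < eps) ->
  continuous f x.
Proof.
intros Hf; apply filterlim_locally; intros eps.
destruct (Hf eps (cond_pos eps)) as [delta Hd].
exists delta; intros y Hy; apply norm_compat1, Hd, Hy.
Qed.

(** Right continuity at 0 propagates: for [p <= q],
    [S(q) y - S(p) y = S(p) (S(q - p) y - y)], and the uniform bound on [S(p)]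
    makes the estimate depend on [q - p] alone, which also yields continuity from
    the left. The orbit is frozen at [y] for negative times so that two-sided
    derivatives of its integral exist at 0. *)
Lemma semigroup_orbit_continuous (H : HilbertSpace) (Sg : R -> H -> H) (K : R)
    (y : H) :
  is_C0_semigroup Sg -> 0 < K ->
  (forall s x, 0 <= s -> norm (Sg s x) <= K * norm x) ->
  forall s, continuous (fun r => Sg (Rmax 0 r) y) s.
Proof.
intros HS HK Hbound s; apply (continuous_norm_lt H); intros eps Heps.
assert (He : 0 < eps / K) by (apply Rdiv_lt_0_compat; lra).
pose proof (C0_continuous _ HS y) as Hc.
assert (Hloc : locally_norm (K := R_AbsRing) (V := H) y
                 (fun z : H => norm (minus z y) < eps / K)).
{ exists (mkposreal _ He); intros z Hz; exact Hz. }
destruct (Hc _ (locally_le_locally_norm (V := H) y _ Hloc)) as [delta Hd].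
exists delta.
assert (Hsmall : forall p q, 0 <= p <= q -> q - p < delta ->
                   norm (minus (Sg q y) (Sg p y)) < eps).
{ intros p q Hpq Hlt.
  assert (Hfac : minus (Sg q y) (Sg p y) = Sg p (minus (Sg (q - p) y) y)).
  { transitivity (minus (Sg p (Sg (q - p) y)) (Sg p y)).
    - f_equal; rewrite <- (C0_plus _ HS) by lra; f_equal; ring.
    - symmetry; apply (linear_minus (V := H) (Sg p)), (C0_linear _ HS); lra. }
  rewrite Hfac.
  apply Rle_lt_trans with (1 := Hbound p _ (proj1 Hpq)).
  assert (Hlt' : norm (minus (Sg (q - p) y) y) < eps / K).
  { destruct (Req_dec (q - p) 0) as [H0 | H0].
    - rewrite H0, (C0_zero _ HS).
      apply Rle_lt_trans with 0; [right | exact He].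
      transitivity (norm (zero : H)); [f_equal | apply hilbert_norm_zero].
      exact (minus_eq_zero (G := H) y).
    - apply Hd; [| lra].
      change (Rabs (q - p - 0) < delta).
      rewrite Rminus_0_r, Rabs_pos_eq; lra. }
  apply Rmult_lt_compat_l with (r := K) in Hlt'; [| exact HK].
  replace (K * (eps / K)) with eps in Hlt' by (field; lra); exact Hlt'. }
intros r Hr; apply Rabs_def2 in Hr.
destruct (Rle_or_lt s r) as [Hsr | Hsr].
- apply Hsmall; unfold Rmax; destruct (Rle_dec 0 s), (Rle_dec 0 r); lra.
- apply Rle_lt_trans with (norm (minus (Sg (Rmax 0 s) y) (Sg (Rmax 0 r) y))).
  { right; exact (norm_minus_sym H _ _). }
  apply Hsmall; unfold Rmax; destruct (Rle_dec 0 s), (Rle_dec 0 r); lra.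
Qed.

Lemma is_derive_shift (V : NormedModule R_AbsRing) (F : R -> V) (k t : R) (l : V) :
  is_derive F (t + k) l -> is_derive (fun s => F (s + k)) t l.
Proof.
intros HF.
assert (Hk : is_derive (fun s : R => s + k) t 1) by (auto_derive; [easy | ring]).
pose proof (is_derive_comp F (fun s => s + k) t l 1 HF Hk) as Hc.
assert (E : scal (1 : R_AbsRing) l = l) by exact (scal_one (V := V) l).
rewrite <- E; exact Hc.
Qed.

Lemma continuous_shift (U : UniformSpace) (f : R -> U) (k t : R) :
  continuous f (t + k) -> continuous (fun s => f (s + k)) t.
Proof.
intros Hf.
apply (continuous_comp (fun s : R => s + k) f); [| exact Hf].
apply (ex_derive_continuous (fun s : R => s + k)); auto_derive; easy.
Qed.

(** With [F] a primitive of the orbit of [y], the vector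
    [F (t + h) - F t] lies in the domain of the generator, and as a function of
    [t] it is an orbit of the semigroup with a two-sided derivative. Dissipativity
    then makes the derivative of its squared norm nonpositive. *)
Lemma dissipative_contraction_average (H : HilbertSpace) (A : unbounded_operator H)
    (Sg : R -> H -> H) (F : R -> H) (y : H) (h : R) :
  dissipative A -> is_C0_semigroup Sg -> is_generator A Sg ->
  (forall s, continuous (fun r => Sg (Rmax 0 r) y) s) ->
  (forall s, is_derive F s (Sg (Rmax 0 s) y)) ->
  0 < h ->
  forall t, 0 <= t -> norm (Sg t (minus (F h) (F 0))) <= norm (minus (F h) (F 0)).
Proof.
intros HA HS HG Hc HF Hh.
set (f := fun r => Sg (Rmax 0 r) y) in *.
set (G := fun t : R => minus (F (t + h)) (F t)).
assert (HG' : forall t, is_derive G t (minus (f (t + h)) (f t))).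
{ intros t; apply (is_derive_minus (V := H)); [apply (is_derive_shift H) |]; apply HF. }
assert (Horbit : forall t k, 0 <= t -> 0 <= k -> Sg k (G t) = G (t + k)).
{ intros t k Ht Hk.
  assert (H1 : is_RInt (fun s => Sg k (f s)) t (t + h) (Sg k (G t))).
  { apply (is_RInt_linear H H); [apply (C0_linear _ HS), Hk |].
    apply (is_RInt_derive (V := H) F f); intros; [apply HF | apply Hc]. }
  assert (H2 : is_RInt (fun s => f (s + k)) t (t + h) (G (t + k))).
  { unfold G; replace (t + k + h) with (t + h + k) by ring.
    apply (is_RInt_derive (V := H) (fun s => F (s + k))); intros x _.
    - apply (is_derive_shift H), HF.
    - apply (continuous_shift H f), Hc. }
  assert (H3 : is_RInt (fun s => Sg k (f s)) t (t + h) (G (t + k))).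
  { apply (is_RInt_ext (V := H) (fun s => f (s + k))); [| exact H2].
    rewrite Rmin_left by lra; intros x Hx; unfold f.
    rewrite !Rmax_right by lra; rewrite Rplus_comm; apply (C0_plus _ HS); lra. }
  rewrite <- (is_RInt_unique (V := H) _ _ _ _ H1).
  exact (is_RInt_unique (V := H) _ _ _ _ H3). }
assert (Hdiss : forall t, 0 <= t -> inner (G t) (minus (f (t + h)) (f t)) <= 0).
{ intros t Ht.
  assert (Hgen : dom A (G t) /\ Defs.uop A (G t) = minus (f (t + h)) (f t)).
  { apply HG.
    apply (filterlim_ext_loc (F := at_right 0)
             (fun k => scal (/ k) (minus (G (t + k)) (G t)))).
    - exists (mkposreal _ Rlt_0_1); intros k _ Hk.
      rewrite <- Horbit; [easy | exact Ht | left; exact Hk].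
    - exact (is_derive_filterlim_right H G t _ (HG' t)). }
  destruct Hgen as [Hdom <-]; rewrite inner_sym; apply HA, Hdom. }
intros t Ht.
assert (HG0 : G 0 = minus (F h) (F 0)) by (unfold G; rewrite Rplus_0_l; easy).
rewrite <- HG0, (Horbit 0 t) by lra; rewrite Rplus_0_l.
destruct (MVT_gen (fun s => norm (G s) ^ 2) 0 t
            (fun s => 2 * inner (G s) (minus (f (s + h)) (f s)))) as [c [Hc1 Hc2]].
- intros x _; apply is_derive_norm_sqr, HG'.
- intros x _; apply continuity_pt_filterlim.
  apply (ex_derive_continuous (fun s => norm (G s) ^ 2)).
  eexists; apply is_derive_norm_sqr, HG'.
- rewrite Rmin_left, Rmax_right in Hc1 by lra.
  pose proof (Hdiss c (proj1 Hc1)).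
  assert (0 <= norm (G 0)) by exact (norm_ge_0 _).
  assert (0 <= norm (G t)) by exact (norm_ge_0 _).
  nra.
Qed.

(** Averages of an orbit over [0, h] tend to its starting point as [h] tends to
    0, so the contraction estimate passes to all vectors. *)
Lemma dissipative_contraction (H : HilbertSpace) (A : unbounded_operator H)
    (Sg : R -> H -> H) (K : R) :
  dissipative A -> is_C0_semigroup Sg -> is_generator A Sg -> 0 < K ->
  (forall s x, 0 <= s -> norm (Sg s x) <= K * norm x) ->
  forall t x, 0 <= t -> norm (Sg t x) <= norm x.
Proof.
intros HA HS HG HK Hbound t y Ht.
pose proof (semigroup_orbit_continuous H Sg K y HS HK Hbound) as Hc.
set (f := fun r => Sg (Rmax 0 r) y) in *.
set (F := fun s => RInt f 0 s).
assert (HF : forall s, is_derive F s (f s)).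
{ intros s; apply (is_derive_RInt (V := H) f F 0 s); [| apply Hc].
  apply filter_forall; intros b; apply (RInt_correct (V := H)).
  apply (ex_RInt_continuous (V := H)); intros; apply Hc. }
set (q := fun h : R => scal (/ h) (minus (F h) (F 0)) : H).
assert (Hq : filterlim q (at_right 0) (locally y)).
{ assert (Hf0 : f 0 = y) by (unfold f; rewrite Rmax_left by lra; apply (C0_zero _ HS)).
  rewrite <- Hf0.
  apply filterlim_ext with (fun k => scal (/ k) (minus (F (0 + k)) (F 0))).
  - intros k; rewrite Rplus_0_l; easy.
  - exact (is_derive_filterlim_right H F 0 _ (HF 0)). }
assert (HSt : is_linear (Sg t)) by (apply (C0_linear _ HS), Ht).
assert (Hle : Rbar_le (norm (Sg t y)) (norm y)).
{ apply (filterlim_le (F := at_right 0) (fun h => norm (Sg t (q h)))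
           (fun h => norm (q h))).
  - exists (mkposreal _ Rlt_0_1); intros h _ Hh.
    pose proof (dissipative_contraction_average H A Sg F y h HA HS HG Hc HF Hh t Ht)
      as Havg.
    assert (Hinv : / h <> 0) by (apply Rgt_not_eq, Rinv_0_lt_compat, Hh).
    (* The scaled norm has an upper bound only, so the lower bound on [norm (q h)]
       comes from scaling [q h] back by [h]. *)
    assert (Hback : scal h (q h) = minus (F h) (F 0)).
    { unfold q; transitivity (scal (one : R_AbsRing) (minus (F h) (F 0))).
      - transitivity (scal (h * / h) (minus (F h) (F 0))).
        + exact (scal_assoc (V := H) h (/ h) _).
        + f_equal; apply Rinv_r, Rgt_not_eq, Hh.
      - exact (scal_one (V := H) _). }
    assert (Hlin : Sg t (q h) = scal (/ h) (Sg t (minus (F h) (F 0))))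
      by exact (linear_scal (V := H) (Sg t) HSt _ _).
    rewrite Hlin.
    apply Rle_trans with (1 := norm_scal_le H _ _).
    assert (Hi : 0 < / h) by (apply Rinv_0_lt_compat, Hh).
    rewrite Rabs_pos_eq by lra.
    assert (Hn : norm (minus (F h) (F 0)) <= Rabs h * norm (q h))
      by (rewrite <- Hback; exact (norm_scal_le H h (q h))).
    rewrite Rabs_pos_eq in Hn by (left; exact Hh).
    apply Rle_trans with (/ h * (h * norm (q h))).
    + apply Rmult_le_compat_l; [lra |].
      apply Rle_trans with (1 := Havg), Hn.
    + right; rewrite <- Rmult_assoc, Rinv_l, Rmult_1_l; [easy | apply Rgt_not_eq, Hh].
  - apply filterlim_comp with (2 := filterlim_norm (V := H) (Sg t y)).
    apply filterlim_comp with (1 := Hq), (linear_cont (V := H) (Sg t)), HSt.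
  - apply filterlim_comp with (1 := Hq), (filterlim_norm (V := H)). }
exact Hle.
Qed.

(** * Mild solutions *)

(** By the semigroup law the part of the integral over [0, s] is the image under
    [Sg (t - s)] of the integral in the formula for [U s]; so a mild solution may
    be restarted at any time [s]. *)
Lemma mild_solution_restart (H : HilbertSpace) (Sg : R -> H -> H)
    (B : R -> H -> H) (tau : R) (U0 : H) (U : R -> H) (s t : R) :
  is_C0_semigroup Sg -> mild_solution Sg B tau U0 U -> 0 <= s <= t ->
  exists I : H,
    is_RInt (fun r => Sg (t - r) (B r (U (r - tau)))) s t I /\
    U t = plus (Sg (t - s) (U s)) I.
Proof.
intros HS [_ HU] Hst.
destruct (HU t) as [Ht HUt]; [lra |].
destruct (HU s) as [Hs HUs]; [lra |].
set (g := fun r => Sg (t - r) (B r (U (r - tau)))) in *.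
pose proof (ex_RInt_Chasles_1 (V := H) g 0 s t Hst Ht) as H0s.
pose proof (ex_RInt_Chasles_2 (V := H) g 0 s t Hst Ht) as Hst'.
exists (RInt g s t); split; [exact (RInt_correct (V := H) _ _ _ Hst') |].
assert (Hlin : is_linear (Sg (t - s))) by (apply (C0_linear _ HS); lra).
assert (Hg : RInt g 0 s
             = Sg (t - s) (RInt (fun r => Sg (s - r) (B r (U (r - tau)))) 0 s)).
{ apply (is_RInt_unique (V := H)).
  apply (is_RInt_ext (V := H)
           (fun r => Sg (t - s) (Sg (s - r) (B r (U (r - tau)))))).
  - rewrite Rmin_left, Rmax_right by lra; intros r Hr; unfold g.
    rewrite <- (C0_plus _ HS) by lra; f_equal; ring.
  - apply (is_RInt_linear H H); [exact Hlin | exact (RInt_correct (V := H) _ _ _ Hs)]. }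
rewrite HUt, HUs.
transitivity (plus (Sg t U0) (plus (RInt g 0 s) (RInt g s t))).
- f_equal; symmetry; exact (RInt_Chasles (V := H) g 0 s t H0s Hst').
- rewrite Hg.
  transitivity (plus (plus (Sg (t - s) (Sg s U0))
                  (Sg (t - s) (RInt (fun r => Sg (s - r) (B r (U (r - tau)))) 0 s)))
                  (RInt g s t)).
  + rewrite <- (C0_plus _ HS) by lra.
    replace (t - s + s) with t by ring.
    exact (plus_assoc (G := H) _ _ _).
  + f_equal; symmetry; exact (linear_plus (V := H) (Sg (t - s)) Hlin _ _).
Qed.

(** * Growth under delayed feedback *)

(** The square of this comparison function is the factor
    [exp (2 b r) (c + b r)] of the stability criterion. *)
Definition growth (b c r : R) : R := exp (b * r) * sqrt (c + b * r).

Definition growth_deriv (b c r : R) : R :=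
  b * growth b c r + exp (b * r) * (b / (2 * sqrt (c + b * r))).

Lemma growth_sqr (b c r : R) :
  0 <= c + b * r -> growth b c r ^ 2 = exp (2 * b * r) * (c + r * b).
Proof.
intros Hc; unfold growth; rewrite Rpow_mult_distr, pow2_sqrt by exact Hc.
rewrite <- Rsqr_pow2; unfold Rsqr; rewrite <- exp_plus.
replace (b * r + b * r) with (2 * b * r) by ring; ring.
Qed.

Lemma growth_le (b c r r' : R) :
  0 <= b -> 0 <= c + b * r -> r <= r' -> growth b c r <= growth b c r'.
Proof.
intros Hb Hc Hr.
assert (Hbr : b * r <= b * r') by (apply Rmult_le_compat_l; lra).
apply Rmult_le_compat.
- left; apply exp_pos.
- apply sqrt_pos.
- destruct Hbr as [Hlt | ->]; [left; apply exp_increasing, Hlt | right; easy].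
- apply sqrt_le_1_alt; lra.
Qed.

Lemma is_derive_growth (b c r : R) :
  0 < c + b * r -> is_derive (growth b c) r (growth_deriv b c r).
Proof.
intros Hc.
assert (0 < sqrt (c + b * r)) by (apply sqrt_lt_R0, Hc).
unfold growth_deriv, growth; auto_derive; [easy | field; lra].
Qed.

Lemma continuous_growth_deriv (b c r : R) :
  0 < c + b * r -> continuous (growth_deriv b c) r.
Proof.
intros Hc.
assert (0 < sqrt (c + b * r)) by (apply sqrt_lt_R0, Hc).
apply (ex_derive_continuous (growth_deriv b c)).
unfold growth_deriv, growth; auto_derive; repeat split; lra.
Qed.

(** [growth b c] is a supersolution of [h' = b max(1, h)]: the lower bound [b]
    comes from [w + 1 / (2 w) >= 1] for [w = sqrt (c + b r)]. *)
Lemma growth_deriv_ge (b c r : R) :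
  0 <= b -> 0 <= r -> 0 < c ->
  b <= growth_deriv b c r /\ b * growth b c r <= growth_deriv b c r.
Proof.
intros Hb Hr Hc.
assert (Hbr : 0 <= b * r) by (apply Rmult_le_pos; lra).
unfold growth_deriv, growth.
set (w := sqrt (c + b * r)).
assert (Hw : 0 < w) by (apply sqrt_lt_R0; lra).
assert (He : 1 <= exp (b * r)) by (pose proof (exp_ineq1_le (b * r)); lra).
assert (Hi : 0 < / (2 * w)) by (apply Rinv_0_lt_compat; lra).
assert (Hwi : 1 <= w + / (2 * w)).
{ apply Rmult_le_reg_r with (2 * w); [lra |].
  replace ((w + / (2 * w)) * (2 * w)) with (2 * w * w + 1) by (field; lra).
  pose proof (pow2_ge_0 (w - 1)); pose proof (pow2_ge_0 w); nra. }
assert (Hbi : 0 <= b * / (2 * w)) by (apply Rmult_le_pos; lra).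
unfold Rdiv; split.
- replace (b * (exp (b * r) * w) + exp (b * r) * (b * / (2 * w)))
    with (b * (exp (b * r) * (w + / (2 * w)))) by ring.
  rewrite <- (Rmult_1_r b) at 1; apply Rmult_le_compat_l; [lra |].
  nra.
- assert (0 <= exp (b * r) * (b * / (2 * w))) by (apply Rmult_le_pos; lra); lra.
Qed.

(** The delay makes the comparison a method of steps: on the k-th interval of
    length [tau] the delayed value is already bounded by [a] (history) or by
    [a * growth] (previous steps), hence the integrand by the derivative of
    [a * growth]. *)
Lemma delayed_feedback_bound (V : NormedModule R_AbsRing) (u : R -> R)
    (q r tau a b c : R) :
  0 < tau -> 0 <= a -> 0 <= b -> 0 < c ->
  (forall s, q - tau <= s <= q -> u s <= a) ->
  (forall t, q <= t <= r -> exists (f : R -> V) (I : V),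
     is_RInt f q t I /\ u t <= sqrt c * a + norm I /\
     (forall s, q <= s <= t -> norm (f s) <= b * u (s - tau))) ->
  forall t, q <= t <= r -> u t <= a * growth b c (t - q).
Proof.
intros Htau Ha Hb Hc Hhist Hint.
assert (Hsteps : forall k : nat, forall t, q <= t <= r -> t <= q + INR k * tau ->
                   u t <= a * growth b c (t - q)).
2: { intros t Ht.
     destruct (INR_unbounded ((t - q) / tau)) as [k Hk].
     apply (Hsteps k); [exact Ht |].
     apply Rmult_gt_compat_r with (r := tau) in Hk; [| exact Htau].
     replace ((t - q) / tau * tau) with (t - q) in Hk by (field; lra); lra. }
assert (Hgrow : forall t, q <= t ->
          (forall s, q <= s <= t -> s - tau >= q ->
             u (s - tau) <= a * growth b c (s - tau - q)) ->
          t <= r -> u t <= a * growth b c (t - q)).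
{ intros t Hqt Hprev Htr.
  destruct (Hint t (conj Hqt Htr)) as [f [I [HI [Hut Hf]]]].
  assert (Hpos : forall s, q <= s -> 0 < c + b * (s - q)).
  { intros s Hs; assert (0 <= b * (s - q)) by (apply Rmult_le_pos; lra); lra. }
  assert (HG : is_RInt (fun s => a * growth_deriv b c (s - q)) q t
                 (a * growth b c (t - q) - a * growth b c (q - q))).
  { apply (is_RInt_derive (V := R_CompleteNormedModule)
             (fun s => a * growth b c (s - q))
             (fun s => a * growth_deriv b c (s - q)));
      rewrite Rmin_left, Rmax_right by lra; intros s Hs.
    - apply is_derive_scal.
      exact (is_derive_shift R_NormedModule (growth b c) (- q) s _
               (is_derive_growth b c (s - q) (Hpos s (proj1 Hs)))).
    - apply (continuous_scal_r (K := R_AbsRing) (V := R_NormedModule) a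
               (fun s => growth_deriv b c (s - q))).
      exact (continuous_shift R_UniformSpace (growth_deriv b c) (- q) s
               (continuous_growth_deriv b c (s - q) (Hpos s (proj1 Hs)))). }
  assert (HnI : norm I <= a * growth b c (t - q) - a * growth b c (q - q)).
  { apply (norm_RInt_le f (fun s => a * growth_deriv b c (s - q)) q t);
      [lra | | exact HI | exact HG].
    intros s Hs; apply Rle_trans with (1 := Hf s Hs).
    destruct (growth_deriv_ge b c (s - q)) as [Hd1 Hd2]; [lra | lra | lra |].
    destruct (Rle_or_lt q (s - tau)) as [Hlate | Hearly].
    - apply Rle_trans with (b * (a * growth b c (s - q))).
      + apply Rmult_le_compat_l; [lra |].
        apply Rle_trans with (1 := Hprev s Hs (Rle_ge _ _ Hlate)).
        apply Rmult_le_compat_l; [lra |].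
        apply growth_le; [lra | | lra].
        left; apply Hpos, Hlate.
      + replace (b * (a * growth b c (s - q))) with (a * (b * growth b c (s - q)))
          by ring.
        apply Rmult_le_compat_l; lra.
    - apply Rle_trans with (b * a).
      + apply Rmult_le_compat_l; [lra |]; apply Hhist; lra.
      + rewrite (Rmult_comm b); apply Rmult_le_compat_l; lra. }
  assert (Hg0 : growth b c (q - q) = sqrt c).
  { unfold growth; replace (b * (q - q)) with 0 by ring.
    rewrite exp_0, Rplus_0_r; ring. }
  rewrite Hg0 in HnI; lra. }
induction k as [| k IH]; intros t Ht Htk.
- simpl in Htk; apply Hgrow; [lra | | lra].
  intros s Hs Hs'; lra.
- rewrite S_INR in Htk; apply Hgrow; [lra | | lra].
  intros s Hs Hs'; apply IH; lra.
Qed.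

(** * One cycle without and with feedback *)

Lemma free_interval (H : HilbertSpace) (Sg : R -> H -> H) (B : R -> H -> H)
    (tau : R) (U0 : H) (U : R -> H) (p q : R) :
  is_C0_semigroup Sg -> mild_solution Sg B tau U0 U -> 0 <= p ->
  (forall s, p <= s < q -> forall x, B s x = zero) ->
  forall s, p <= s <= q -> U s = Sg (s - p) (U p).
Proof.
intros HS HU Hp HB s Hs.
destruct (mild_solution_restart H Sg B tau U0 U p s HS HU) as [I [HI ->]]; [lra |].
assert (HI0 : is_RInt (fun r => Sg (s - r) (B r (U (r - tau)))) p s (zero : H)).
{ apply (is_RInt_ext (V := H) (fun _ => zero : H)).
  - rewrite Rmin_left, Rmax_right by lra; intros r Hr.
    rewrite HB by lra; symmetry.
    apply (linear_zero (V := H) (Sg (s - r))), (C0_linear _ HS); lra.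
  - assert (E : scal (s - p) (zero : H) = zero) by exact (scal_zero_r (V := H) _).
    assert (H0 : is_RInt (fun _ => zero : H) p s (scal (s - p) (zero : H)))
      by exact (is_RInt_const (V := H) p s zero).
    rewrite E in H0; exact H0. }
assert (E : I = zero).
{ rewrite <- (is_RInt_unique (V := H) _ _ _ _ HI).
  exact (is_RInt_unique (V := H) _ _ _ _ HI0). }
rewrite E; exact (plus_zero_r (G := H) _).
Qed.

(** Contraction bounds both the kernel of the integral and the history on
    [[p, q]]; decay is used only for the free part [Sg (t - q) (U q)], where it
    produces the factor [sqrt c]. *)
Lemma feedback_interval (H : HilbertSpace) (Sg : R -> H -> H) (B : R -> H -> H)
    (M mu tau : R) (U0 : H) (U : R -> H) (L : H -> H) (p q r : R) :
  is_C0_semigroup Sg -> mild_solution Sg B tau U0 U ->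
  (forall s x, 0 <= s -> norm (Sg s x) <= norm x) ->
  (forall s x, 0 <= s -> norm (Sg s x) <= M * exp (- mu * s) * norm x) ->
  0 < M -> 0 < tau -> 0 <= p -> tau <= q - p -> is_linear L ->
  (forall s, p <= s < q -> forall x, B s x = zero) ->
  (forall s, q <= s < r -> forall x, B s x = L x) ->
  (forall x, B r x = zero) ->
  forall t, q <= t <= r ->
    norm (U t)
    <= norm (U p) * growth (op_norm L) (M ^ 2 * exp (- 2 * mu * (q - p))) (t - q).
Proof.
intros HS HU Hcontr Hdecay HM Htau Hp Hpq HL HBfree HBfeed HBr.
pose proof (free_interval H Sg B tau U0 U p q HS HU Hp HBfree) as Hfree.
pose proof (op_norm_ge_0 H L HL) as Hb.
assert (Hc : 0 < M ^ 2 * exp (- 2 * mu * (q - p))).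
{ apply Rmult_lt_0_compat; [apply pow_lt, HM | apply exp_pos]. }
assert (Hsqrt : sqrt (M ^ 2 * exp (- 2 * mu * (q - p))) = M * exp (- mu * (q - p))).
{ replace (M ^ 2 * exp (- 2 * mu * (q - p))) with ((M * exp (- mu * (q - p))) ^ 2).
  - apply sqrt_pow2, Rmult_le_pos; [lra | left; apply exp_pos].
  - rewrite Rpow_mult_distr; f_equal.
    rewrite <- Rsqr_pow2; unfold Rsqr; rewrite <- exp_plus; f_equal; ring. }
apply (delayed_feedback_bound H (fun s => norm (U s)) q r tau).
- exact Htau.
- exact (norm_ge_0 _).
- exact Hb.
- exact Hc.
- intros s Hs; rewrite Hfree by lra; apply Hcontr; lra.
- intros t Ht.
  destruct (mild_solution_restart H Sg B tau U0 U q t HS HU) as [I [HI HUt]]; [lra |].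
  exists (fun s => Sg (t - s) (B s (U (s - tau)))), I.
  split; [exact HI | split].
  + rewrite HUt, Hsqrt.
    apply Rle_trans with (norm (Sg (t - q) (U q)) + norm I).
    { exact (norm_triangle (V := H) _ _). }
    apply Rplus_le_compat_r.
    apply Rle_trans with (norm (U q)); [apply Hcontr; lra |].
    rewrite Hfree by lra; apply Hdecay; lra.
  + intros s Hs; apply Rle_trans with (norm (B s (U (s - tau)))).
    { apply Hcontr; lra. }
    (* At the right end of the interval the feedback is already switched off. *)
    destruct (Rle_lt_dec r s) as [Hrs | Hrs].
    * replace s with r by lra; rewrite HBr, hilbert_norm_zero.
      apply Rmult_le_pos; [exact Hb | exact (norm_ge_0 _)].
    * rewrite HBfeed by lra; apply norm_le_op_norm, HL.
Qed.

(** * Decay along the cycles *)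

Lemma between_consecutive_terms (x : nat -> R) (N k : nat) (s : R) :
  x N <= s < x (N + k)%nat -> exists n, (N <= n)%nat /\ x n <= s < x (S n).
Proof.
induction k as [| k IH]; intros Hs.
- rewrite Nat.add_0_r in Hs; lra.
- destruct (Rlt_or_le s (x (N + k)%nat)) as [Hlt | Hle].
  + apply IH; lra.
  + exists (N + k)%nat; split; [lia |]; rewrite <- Nat.add_succ_r; lra.
Qed.

Lemma le_exp_sum_ln (x Q : nat -> R) :
  (forall n, 0 < Q n) -> (forall n, x (S n) <= Q n * x n) ->
  forall n, x (S n) <= exp (sum_n (fun k => ln (Q k)) n) * x 0%nat.
Proof.
intros HQ Hx; induction n as [| n IH].
- rewrite sum_O, exp_ln by apply HQ; apply Hx.
- rewrite sum_Sn; apply Rle_trans with (1 := Hx (S n)).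
  change (plus (sum_n (fun k => ln (Q k)) n) (ln (Q (S n))))
    with (sum_n (fun k => ln (Q k)) n + ln (Q (S n))).
  rewrite exp_plus, exp_ln by apply HQ.
  rewrite (Rmult_comm (exp _)), Rmult_assoc.
  apply Rmult_le_compat_l; [left; apply HQ | exact IH].
Qed.

Theorem theorem3p3 :
  forall (H : HilbertSpace) (A : unbounded_operator H) (Sg : R -> H -> H)
    (M mu tau : R) (t : nat -> R) (Bop : nat -> H -> H) (B : R -> H -> H),
  dissipative A ->
  is_C0_semigroup Sg ->
  is_generator A Sg ->
  0 < M -> 0 < mu ->
  (forall s, 0 <= s -> op_norm (Sg s) <= M * exp (- mu * s)) ->
  0 < tau ->
  t 0%nat = 0 ->
  (forall n, t n < t (n + 1)%nat) ->
  (forall n, is_linear (Bop (2 * n + 1)%nat)) ->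
  (forall n s, t (2 * n)%nat <= s < t (2 * n + 1)%nat ->
     forall x, B s x = zero) ->
  (forall n s, t (2 * n + 1)%nat <= s < t (2 * n + 2)%nat ->
     forall x, B s x = Bop (2 * n + 1)%nat x) ->
  let T := fun n : nat => t (n + 1)%nat - t n in
  let b := fun n : nat => op_norm (Bop n) in
  let Tstar := 1 / mu * ln M in
  let c := fun n : nat => M ^ 2 * exp (- 2 * mu * T (2 * n)%nat) in
  (forall n, T (2 * n)%nat >= tau) ->
  (forall n, T (2 * n)%nat > Tstar) ->
  is_lim_seq
    (fun N => sum_n (fun n =>
       ln (exp (2 * b (2 * n + 1)%nat * T (2 * n + 1)%nat)
           * (c n + T (2 * n + 1)%nat * b (2 * n + 1)%nat))) N)
    m_infty ->
  asymptotically_stable Sg B tau.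
Proof.
intros H A Sg M mu tau t Bop B HA HS HG HM Hmu Hdec Htau Ht0 Hinc HL HBfree HBfeed
  T b Tstar c HT _ Hsum U0 U HU.
assert (Hdecay : forall s x, 0 <= s -> norm (Sg s x) <= M * exp (- mu * s) * norm x).
{ intros s x Hs; apply Rle_trans with (op_norm (Sg s) * norm x).
  - apply norm_le_op_norm, (C0_linear _ HS), Hs.
  - apply Rmult_le_compat_r; [exact (norm_ge_0 x) | apply Hdec, Hs]. }
assert (Hcontr : forall s x, 0 <= s -> norm (Sg s x) <= norm x).
{ apply (dissipative_contraction H A Sg M HA HS HG HM).
  intros s x Hs; apply Rle_trans with (1 := Hdecay s x Hs).
  apply Rmult_le_compat_r; [exact (norm_ge_0 x) |].
  assert (exp (- mu * s) <= exp 0).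
  { assert (Hms : - mu * s <= 0) by nra.
    destruct Hms as [Hlt | ->]; [left; apply exp_increasing, Hlt | right; easy]. }
  rewrite exp_0 in *; nra. }
set (p := fun n : nat => t (2 * n)%nat).
assert (HpS : forall n, t (2 * n + 2)%nat = p (S n)).
{ intros n; unfold p; f_equal; lia. }
assert (Hcycle : forall n, p n + tau <= t (2 * n + 1)%nat < p (S n)).
{ intros n; split.
  - specialize (HT n); unfold T in HT; unfold p; lra.
  - rewrite <- HpS; replace (2 * n + 2)%nat with (2 * n + 1 + 1)%nat by lia.
    apply Hinc. }
assert (Hpn : forall n, INR n * tau <= p n).
{ induction n as [| n IH]; [unfold p; simpl; rewrite Ht0; lra |].
  rewrite S_INR; pose proof (Hcycle n); lra. }
assert (Hp0 : forall n, 0 <= p n).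
{ intros n; apply Rle_trans with (2 := Hpn n).
  apply Rmult_le_pos; [apply pos_INR | lra]. }
set (Q := fun n => exp (2 * b (2 * n + 1)%nat * T (2 * n + 1)%nat)
                   * (c n + T (2 * n + 1)%nat * b (2 * n + 1)%nat)).
assert (Hb : forall n, 0 <= b (2 * n + 1)%nat) by (intros n; apply op_norm_ge_0, HL).
assert (Hc : forall n, 0 < c n).
{ intros n; apply Rmult_lt_0_compat; [apply pow_lt, HM | apply exp_pos]. }
assert (HTodd : forall n, T (2 * n + 1)%nat = p (S n) - t (2 * n + 1)%nat).
{ intros n; unfold T; rewrite <- HpS; f_equal; f_equal; lia. }
assert (HQ : forall n, 0 < Q n).
{ intros n; apply Rmult_lt_0_compat; [apply exp_pos |].
  assert (0 <= T (2 * n + 1)%nat * b (2 * n + 1)%nat).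
  { apply Rmult_le_pos; [rewrite HTodd; pose proof (Hcycle n); lra | apply Hb]. }
  pose proof (Hc n); lra. }
assert (Heven : forall n s, p n <= s <= t (2 * n + 1)%nat ->
                  norm (U s) ^ 2 <= norm (U (p n)) ^ 2).
{ intros n s Hs; apply pow_incr; split; [exact (norm_ge_0 _) |].
  rewrite (free_interval H Sg B tau U0 U (p n) (t (2 * n + 1)%nat) HS HU (Hp0 n)
             (HBfree n) s Hs).
  apply Hcontr; lra. }
assert (Hodd : forall n s, t (2 * n + 1)%nat <= s <= p (S n) ->
                 norm (U s) ^ 2 <= Q n * norm (U (p n)) ^ 2).
{ intros n s Hs.
  set (h := growth (b (2 * n + 1)%nat) (c n)).
  assert (Hpos : forall d, 0 <= d -> 0 <= c n + b (2 * n + 1)%nat * d).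
  { intros d Hd; pose proof (Hc n).
    assert (0 <= b (2 * n + 1)%nat * d) by (apply Rmult_le_pos; [apply Hb | exact Hd]).
    lra. }
  assert (HUs : norm (U s) <= norm (U (p n)) * h (T (2 * n + 1)%nat)).
  { apply Rle_trans with (norm (U (p n)) * h (s - t (2 * n + 1)%nat)).
    - apply (feedback_interval H Sg B M mu tau U0 U (Bop (2 * n + 1)%nat) (p n)
               (t (2 * n + 1)%nat) (p (S n)) HS HU Hcontr Hdecay HM Htau (Hp0 n)).
      + pose proof (Hcycle n); lra.
      + apply HL.
      + apply HBfree.
      + rewrite <- HpS; apply HBfeed.
      + apply (HBfree (S n)); pose proof (Hcycle (S n)); unfold p in *; lra.
      + exact Hs.
    - apply Rmult_le_compat_l; [exact (norm_ge_0 _) |].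
      apply growth_le; [apply Hb | apply Hpos; lra | rewrite HTodd; lra]. }
  apply Rle_trans with ((norm (U (p n)) * h (T (2 * n + 1)%nat)) ^ 2).
  - apply pow_incr; split; [exact (norm_ge_0 _) | exact HUs].
  - rewrite Rpow_mult_distr; unfold h; rewrite growth_sqr.
    + right; apply Rmult_comm.
    + apply Hpos; rewrite HTodd; pose proof (Hcycle n); lra. }
pose proof (le_exp_sum_ln (fun n => norm (U (p n)) ^ 2) Q HQ) as Hprod.
cbv beta in Hprod.
specialize (Hprod (fun n => Hodd n (p (S n)) (conj (Rlt_le _ _ (proj2 (Hcycle n)))
                                                 (Rle_refl _)))).
set (a := norm (U (p 0%nat)) ^ 2) in *.
assert (Ha : 0 <= a) by apply pow2_ge_0.
apply is_lim_spec; intros eps.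
pose proof (cond_pos eps) as Heps.
assert (Hthr : 0 < eps ^ 2 / (a + 1)) by (apply Rdiv_lt_0_compat; nra).
apply is_lim_seq_spec in Hsum.
destruct (Hsum (ln (eps ^ 2 / (a + 1)))) as [N HN].
assert (Hsmall : forall n, (N <= n)%nat -> exp (sum_n (fun k => ln (Q k)) n) * a < eps ^ 2).
{ intros n Hn; specialize (HN n Hn).
  apply exp_increasing in HN; rewrite exp_ln in HN by exact Hthr.
  apply Rle_lt_trans with (exp (sum_n (fun k => ln (Q k)) n) * (a + 1)).
  - apply Rmult_le_compat_l; [left; apply exp_pos | lra].
  - replace (eps ^ 2) with (eps ^ 2 / (a + 1) * (a + 1)) by (field; lra).
    apply Rmult_lt_compat_r; [lra | exact HN]. }
(* A bound by the [m]-th partial sum holds on cycle [m + 1], hence the shift. *)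
exists (p (S N)); intros s Hs.
rewrite Rminus_0_r, Rabs_pos_eq by exact (norm_ge_0 _).
destruct (INR_unbounded (s / tau)) as [k Hk].
assert (Hsk : s < p (S N + k)%nat).
{ apply Rlt_le_trans with (INR (S N + k) * tau); [| apply Hpn].
  apply Rmult_gt_compat_r with (r := tau) in Hk; [| exact Htau].
  replace (s / tau * tau) with s in Hk by (field; lra).
  rewrite plus_INR; pose proof (pos_INR (S N)); nra. }
destruct (between_consecutive_terms p (S N) k s) as [[| m] [Hm Hsm]]; [lra | lia |].
assert (Hsq : norm (U s) ^ 2 < eps ^ 2).
{ destruct (Rle_or_lt s (t (2 * S m + 1)%nat)) as [Hfree | Hfeed].
  - apply Rle_lt_trans with (1 := Heven (S m) s (conj (proj1 Hsm) Hfree)).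
    apply Rle_lt_trans with (1 := Hprod m), Hsmall; lia.
  - apply Rle_lt_trans with (Q (S m) * norm (U (p (S m))) ^ 2).
    + apply Hodd; lra.
    + apply Rle_lt_trans with (2 := Hsmall (S m) ltac:(lia)).
      rewrite sum_Sn.
      change (plus (sum_n (fun k => ln (Q k)) m) (ln (Q (S m))))
        with (sum_n (fun k => ln (Q k)) m + ln (Q (S m))).
      rewrite exp_plus, exp_ln, (Rmult_comm (exp _)), Rmult_assoc by apply HQ.
      apply Rmult_le_compat_l; [left; apply HQ | apply Hprod]. }
assert (0 <= norm (U s)) by exact (norm_ge_0 _).
apply Rnot_le_lt; intros Hle.
assert (eps ^ 2 <= norm (U s) ^ 2) by (apply pow_incr; lra).
lra.
Qed.
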